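(* Let $m\ge 2$ and let $p_j=(x_j,y_j)^T\in\mathbb{R}^2$, $j=1,\ldots,m$, be points such that $x_j\neq x_k$ for all $j\neq k$. For any real $p>1$ there exists a unique linear function $y(x)=ax+b$ ($a,b\in\mathbb{R}$) with minimal algebraic $L^p$-distance to the set $\{p_1,\ldots,p_m\}$. A linear function $y(x)=ax+b$ with $a,b\in\mathbb{R}$ has minimal algebraic $L^p$-distance to $\{p_1,\ldots,p_m\}$ if and only if $a$ and $b$ satisfy the two equations $$\sum_{j\in J_-}|y_j-ax_j-b|^{p-1}=\sum_{j\in J_+}|y_j-ax_j-b|^{p-1}$$ and $$\sum_{j\in J_-}x_j|y_j-ax_j-b|^{p-1}=\sum_{j\in J_+}x_j|y_j-ax_j-b|^{p-1}.$$
   Context: A linear function $y(x)=ax+b$ has minimal algebraic $L^p$-distance to $\{p_1,\ldots,p_m\}$ if $(a,b)$ is a global minimum point of $f:\mathbb{R}^2\to\mathbb{R}$, $f(a,b)=\sum_{j=1}^m|y_j-(ax_j+b)|^p$. For given $(a,b)$ the index sets are $J_+=\{j:y_j>ax_j+b\}$ and $J_-=\{j:y_j<ax_j+b\}$. *)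

(* Defs.v *)
From HB Require Import structures.
From mathcomp Require Import all_boot all_order all_algebra.
From mathcomp Require Import reals exp.

Set Implicit Arguments.
Unset Strict Implicit.
Unset Printing Implicit Defensive.

Import Order.TTheory GRing.Theory Num.Theory.

Local Open Scope ring_scope.

(* The points are [pt j = (x_j, y_j)], and a linear function x |-> a * x + b
   is represented by its pair of coefficients [(a, b)].  Real powers are
   [powR], for which [0 `^ p = 0] whenever [p != 0]. *)
Section AlgebraicLpDistance.
Context {R : realType} {m : nat}.
Implicit Types (pt : 'I_m -> R * R) (p : R) (ab : R * R).

Definition Lp_objective p pt ab : R :=
  \sum_(j < m) `|(pt j).2 - (ab.1 * (pt j).1 + ab.2)| `^ p.

Definition minimal_Lp_distance p pt ab : Prop :=
  forall ab' : R * R, Lp_objective p pt ab <= Lp_objective p pt ab'.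

Definition Jplus pt ab : {set 'I_m} :=
  [set j | (pt j).2 > ab.1 * (pt j).1 + ab.2].

Definition Jminus pt ab : {set 'I_m} :=
  [set j | (pt j).2 < ab.1 * (pt j).1 + ab.2].

End AlgebraicLpDistance.

(* Main.v *)
Require Import Defs.
From HB Require Import structures.
From mathcomp Require Import all_boot all_order all_algebra.
From mathcomp Require Import ring lra.
From mathcomp Require Import boolp classical_sets reals topology normedtype.
From mathcomp Require Import sequences derive exp.

(** Write r_j = y_j - (a x_j + b) for the residuals and q = p - 1.  The theorem
    rests on one inequality of real numbers, strict for s <> t,
<<
      |t|^p + p sgn(t) |t|^q (s - t) < |s|^p,
>>
    which says that |.|^p is strictly convex and lies above its tangents
    ([powR_norm_gt_tangent]; it reduces to Bernoulli's inequality for real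
    exponents).  Summed over the points, it puts the objective above its tangent
    plane at any (a, b) ([Lp_objective_ge_tangent]), strictly away from (a, b)
    as soon as two abscissas differ, because two distinct lines cannot have the
    same residuals at both of these points ([Lp_objective_gt_tangent]).

    The tangent plane has two coefficients, proportional to the sums over j of
    sgn(r_j) |r_j|^q and of x_j sgn(r_j) |r_j|^q.  Splitting each sum by the
    sign of r_j turns their vanishing into the two equations of the theorem
    ([sum_signed_powR_residual]).

    If they vanish, the tangent plane is horizontal and (a, b) is a minimum;
    strictness makes it the only one.  Conversely no differentiation is needed:
    at a minimum ab, the tangent inequality based at ab + h d with h > 0 and
    evaluated at ab bounds the slope in direction d at ab + h d, and h -> 0
    carries the bound to ab, since t |-> sgn(t) |t|^q is continuous
    ([minimal_descent_rate_le0]).  Applied to d and - d, this makes the slope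
    vanish ([minimal_iff_descent_rate0]).

    A minimum exists because the objective is continuous and its sublevel sets
    are bounded: a bound on the residuals at two distinct abscissas bounds the
    line ([Lp_objective_sublevel_bounded]). *)

Set Implicit Arguments.
Unset Strict Implicit.
Unset Printing Implicit Defensive.

Import Order.TTheory GRing.Theory Num.Theory.
Import numFieldNormedType.Exports.

Local Open Scope classical_set_scope.
Local Open Scope ring_scope.

(** * Absolute powers and their tangents *)

Section RealPowers.
Context {R : realType}.
Implicit Types p q s t u : R.

(** The logarithm is strictly below its tangent at 1.  Since u is the average of
    1 and A := 1 + p (u - 1) with weights (p - 1) / p and 1 / p, averaging this
    bound at 1 / u and A / u gives ln A < p ln u when A > 0. *)
Lemma strict_bernoulli_powR p u : 1 < p -> 0 <= u -> u != 1 ->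
  1 + p * (u - 1) < u `^ p.
Proof.
move=> p1 u0 u1; have p0 : 0 < p by lra.
have [->|un0] := eqVneq u 0; first by rewrite powR0 ?gt_eqF//; lra.
have {un0}u0 : 0 < u by rewrite lt_def un0.
set A := 1 + _; have [A0|A0] := leP A 0.
  exact: le_lt_trans A0 (powR_gt0 _ u0).
rewrite -ltr_ln ?posrE ?powR_gt0// ln_powR.
have tangent (x : R) : 0 < x -> x != 1 -> ln x < x - 1.
  move=> x0 x1; have := @expR_gt1Dx _ (ln x); rewrite ln_eq0// lnK ?posrE//.
  by move=> /(_ x1); lra.
have u'0 : 0 < u^-1 by rewrite invr_gt0.
have /(tangent _ u'0) : u^-1 != 1 by rewrite invr_eq1.
have /(tangent _ (mulr_gt0 A0 u'0)) : A / u != 1.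
  apply: contra u1 => /eqP Au; apply/eqP.
  have : A = u by rewrite -[u]mul1r -Au mulfVK// gt_eqF.
  rewrite /A => Au'; have /eqP : (p - 1) * (u - 1) = 0 by lra.
  by rewrite mulf_eq0 => /orP[]/eqP; lra.
rewrite ln_div ?posrE// lnV ?posrE// => lnA lnu.
have : (p - 1) * - ln u < (p - 1) * (u^-1 - 1) by rewrite ltr_pM2l//; lra.
have AuE : A / u = p - (p - 1) / u.
  by rewrite /A; field; rewrite gt_eqF.
by rewrite AuE in lnA; lra.
Qed.

(** The function sgn(t) |t|^q for q != 0.  Written with positive and negative
    parts, it is visibly odd, and continuous because each part is. *)
Definition signed_powR q t := Num.max t 0 `^ q - Num.max (- t) 0 `^ q.

Lemma signed_powR_gt0E q t : q != 0 -> 0 < t -> signed_powR q t = `|t| `^ q.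
Proof.
move=> q0 t0; rewrite /signed_powR max_l ?max_r ?oppr_le0 ?ltW//.
by rewrite powR0// subr0 gtr0_norm.
Qed.

Lemma signed_powRN q t : signed_powR q (- t) = - signed_powR q t.
Proof. by rewrite /signed_powR opprK opprB. Qed.

Lemma signed_powR0 q : signed_powR q 0 = 0.
Proof. by rewrite /signed_powR oppr0 subrr. Qed.

(** By oddness one may take t >= 0.  For t > 0 and s >= 0 this is Bernoulli's
    inequality at s / t, scaled by t^p; for s < 0 the left-hand side is already
    negative, as it increases with s and is (1 - p) t^p at s = 0. *)
Lemma powR_norm_gt_tangent p s t : 1 < p -> s != t ->
  `|t| `^ p + p * signed_powR (p - 1) t * (s - t) < `|s| `^ p.
Proof.
move=> p1; have p0 : p != 0 by rewrite gt_eqF//; lra.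
have q0 : p - 1 != 0 by rewrite gt_eqF//; lra.
wlog: s t / 0 <= t => [wlog_t|].
  have [/wlog_t|t0 st] := leP 0 t; first exact.
  have := wlog_t (- s) (- t); rewrite oppr_ge0 ltW// eqr_opp st.
  by rewrite !normrN signed_powRN => /(_ _)/(_ isT); lra.
rewrite le_eqVlt => /predU1P[<- s0|t0 st].
  rewrite normr0 powR0// signed_powR0 !(mulr0, mul0r) addr0.
  by rewrite powR_gt0 ?normr_gt0.
rewrite signed_powR_gt0E// gtr0_norm//.
have tp : t `^ p = t * t `^ (p - 1) by rewrite mulr_powRB1//; lra.
have tq := powR_gt0 (p - 1) t0.
have [s0|s0] := leP 0 s; last first.
  apply: lt_le_trans (powR_ge0 _ _); rewrite tp.
  have -> : t * t `^ (p - 1) + p * t `^ (p - 1) * (s - t) =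
    t `^ (p - 1) * (p * s - (p - 1) * t) by lra.
  by rewrite pmulr_rlt0//; nra.
have u1 : s / t != 1.
  by apply: contra st => /eqP u; rewrite -[s](@mulfVK _ t) ?u ?mul1r// gt_eqF.
have /(strict_bernoulli_powR p1)/(_ u1) : 0 <= s / t by rewrite divr_ge0// ltW.
rewrite -(ltr_pM2l (powR_gt0 p t0)) -powRM ?divr_ge0 ?(ltW t0)//.
rewrite [t * (s / t)]mulrC mulfVK ?gt_eqF// ger0_norm//; apply: le_lt_trans.
rewrite le_eqVlt; apply/orP; left; apply/eqP; rewrite tp.
by field; rewrite gt_eqF.
Qed.

(** Away from 0 the function is expR (q ln |t|).  At 0, where [powR] is defined
    by cases, |s| < e^(1/q) gives |s|^q < e. *)
Lemma continuous_powR_norm q : 0 < q -> continuous (fun t : R => `|t| `^ q).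
Proof.
move=> q0 t; rewrite /continuous_at; have [->|t0] := eqVneq t 0; last first.
  have -> : `|t| `^ q = expR (q * ln `|t|).
    by rewrite /powR normr_eq0 (negbTE t0).
  apply: (@cvg_trans _ ((expR (q * ln `|s|)) @[s --> t])).
    apply: near_eq_cvg; near=> s; rewrite /powR normr_eq0.
    have /negbTE-> // : s != 0.
    by near: s; apply: (@cvgr_neq0 _ _ _ (nbhs t) _ id t) => //; exact: cvg_id.
  apply: (@cvg_comp _ _ _ (fun s => q * ln `|s|) expR); last first.
    exact: continuous_expR.
  apply: cvgMl_tmp.
  have ln_cont : {for `|t|, continuous (@ln R)}.
    by apply: continuous_ln; rewrite normr_gt0.
  exact: (cvg_comp _ _ (@norm_continuous _ R t) ln_cont).
rewrite normr0 powR0 ?gt_eqF//; apply/cvgr0Pnorm_lt => e e0.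
near=> s; rewrite ger0_norm ?powR_ge0//.
have -> : e = (e `^ q^-1) `^ q by rewrite -powRrM mulVf ?gt_eqF// powRr1// ltW.
apply: gt0_ltr_powR; rewrite ?nnegrE ?powR_ge0//.
by near: s; apply: cvgr0_norm_lt; [exact: cvg_id|exact: powR_gt0].
Unshelve. all: by end_near. Qed.

Lemma continuous_signed_powR q : 0 < q -> continuous (signed_powR q).
Proof.
move=> q0 t; pose pw (s : R) := `|s| `^ q.
have -> : signed_powR q = fun s => pw (Num.max s 0) - pw (Num.max (- s) 0).
  by apply/funext => s; rewrite /signed_powR /pw !ger0_norm// le_max lexx orbT.
apply: cvgB.
- apply: (@cvg_comp _ _ _ _ pw); last exact: continuous_powR_norm.
  by apply: (@continuous_max _ _ id (fun=> 0)); [exact: cvg_id|exact: cvg_cst].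
- apply: (@cvg_comp _ _ _ _ pw); last exact: continuous_powR_norm.
  by apply: (@continuous_max _ _ -%R (fun=> 0));
    [exact: continuousN|exact: cvg_cst].
Qed.

End RealPowers.

(** * The objective and its tangent planes *)

Section LpFit.
Context {R : realType} {m : nat}.
Variables (pt : 'I_m -> R * R) (p : R).
Hypothesis p_gt1 : 1 < p.
Implicit Types ab d : R * R.

Definition lin d (x : R) : R := d.1 * x + d.2.

Definition residual ab j : R := (pt j).2 - lin ab (pt j).1.

(** The derivative of the objective at [ab] in direction [d], divided by - p. *)
Definition descent_rate ab d : R :=
  \sum_j lin d (pt j).1 * signed_powR (p - 1) (residual ab j).

Let Lp_term_gt_tangent ab ab' j : residual ab' j != residual ab j ->
  `|residual ab j| `^ p -
    p * (lin (ab' - ab) (pt j).1 * signed_powR (p - 1) (residual ab j)) <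
  `|residual ab' j| `^ p.
Proof.
move=> ne; apply: le_lt_trans (powR_norm_gt_tangent p_gt1 ne).
by rewrite /residual /lin /=; lra.
Qed.

Let Lp_term_ge_tangent ab ab' j :
  `|residual ab j| `^ p -
    p * (lin (ab' - ab) (pt j).1 * signed_powR (p - 1) (residual ab j)) <=
  `|residual ab' j| `^ p.
Proof.
have [e|/Lp_term_gt_tangent/ltW//] := eqVneq (residual ab' j) (residual ab j).
rewrite e; suff -> : lin (ab' - ab) (pt j).1 = 0 by rewrite mul0r mulr0 subr0.
by move: e; rewrite /residual /lin /=; lra.
Qed.

Lemma Lp_objective_ge_tangent ab ab' :
  Lp_objective p pt ab - p * descent_rate ab (ab' - ab) <= Lp_objective p pt ab'.
Proof.
rewrite mulr_sumr -sumrB; apply: ler_sum => j _; exact: Lp_term_ge_tangent.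
Qed.

(** Two lines with equal residuals at the distinct abscissas of j and k are the
    same, so at least one term of the sum satisfies the strict inequality. *)
Lemma Lp_objective_gt_tangent ab ab' (j k : 'I_m) :
    (pt j).1 != (pt k).1 -> ab' != ab ->
  Lp_objective p pt ab - p * descent_rate ab (ab' - ab) < Lp_objective p pt ab'.
Proof.
move=> xjk ne; have [i ne_i] : exists i, residual ab' i != residual ab i.
  have [ej|] := eqVneq (residual ab' j) (residual ab j); last by exists j.
  have [ek|] := eqVneq (residual ab' k) (residual ab k); last by exists k.
  case/eqP: ne; case: ab ab' ej ek => [a b] [a' b'].
  rewrite /residual /lin /= => ej ek.
  have /eqP : (a' - a) * ((pt j).1 - (pt k).1) = 0 by lra.
  rewrite mulf_eq0 [_ - (pt k).1 == 0]subr_eq0 (negbTE xjk) orbF subr_eq0.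
  by move=> /eqP aE; subst a'; congr (_, _); lra.
rewrite mulr_sumr -sumrB (bigD1 i)//= [ltRHS](bigD1 i)//=.
apply: ltr_leD; first exact: Lp_term_gt_tangent.
by apply: ler_sum => l _; exact: Lp_term_ge_tangent.
Qed.

Lemma descent_rateE ab d :
  descent_rate ab d =
    d.1 * (\sum_j (pt j).1 * signed_powR (p - 1) (residual ab j)) +
    d.2 * (\sum_j signed_powR (p - 1) (residual ab j)).
Proof.
rewrite !mulr_sumr -big_split /=; apply: eq_bigr => j _.
by rewrite /lin mulrDl mulrA.
Qed.

(** * First-order characterization of the minimizers *)

(** Convexity replaces differentiation: the tangent inequality is based at the
    moving point [ab + h d] and evaluated at the minimizer, which gives the sign
    of the slope at the moving point for every h > 0. *)
Lemma minimal_descent_rate_le0 ab d :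
  minimal_Lp_distance p pt ab -> descent_rate ab d <= 0.
Proof.
move=> min_ab; pose step (h : R) := (ab.1 + h * d.1, ab.2 + h * d.2).
have step0 : step 0 = ab by rewrite /step !mul0r !addr0 -surjective_pairing.
rewrite -step0.
have cvg_step :
    descent_rate (step h) d @[h --> 0^'+] --> descent_rate (step 0) d.
  apply: cvg_at_right_filter.
  apply: cvg_big => [|j _]; first exact: add_continuous.
  apply: cvgMl_tmp.
  apply: (@cvg_comp _ _ _ _ (signed_powR (p - 1))); last first.
    by apply: continuous_signed_powR; rewrite subr_gt0.
  apply: cvgB; first exact: cvg_cst.
  apply: cvgD; first apply: cvgMr_tmp; (apply: cvgD; first exact: cvg_cst);
    by apply: cvgMr_tmp; exact: cvg_id.
apply: (cvgr_to_le cvg_step); near=> h.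
have h0 : 0 < h by near: h; exact: nbhs_right_gt.
have := le_trans (Lp_objective_ge_tangent (step h) ab) (min_ab (step h)).
have -> : descent_rate (step h) (ab - step h) = - h * descent_rate (step h) d.
  by rewrite !descent_rateE /=; lra.
rewrite gerDl mulNr mulrN opprK pmulr_rle0 ?pmulr_rle0//.
exact: lt_trans p_gt1.
Unshelve. all: by end_near. Qed.

Lemma minimal_iff_descent_rate0 ab :
  minimal_Lp_distance p pt ab <-> forall d, descent_rate ab d = 0.
Proof.
split=> [min_ab d|stat ab'].
  apply/eqP; rewrite eq_le minimal_descent_rate_le0//=.
  have := minimal_descent_rate_le0 (- d) min_ab.
  by rewrite !descent_rateE /=; lra.
by have := Lp_objective_ge_tangent ab ab'; rewrite stat mulr0 subr0.
Qed.

(** * Existence of a minimizer *)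

Lemma continuous_Lp_objective : continuous (Lp_objective p pt).
Proof.
move=> ab; apply: cvg_big => [|j _]; first exact: add_continuous.
apply: (@cvg_comp _ _ _ _ (fun t : R => `|t| `^ p)); last first.
  by apply: continuous_powR_norm; exact: lt_trans p_gt1.
apply: cvgB; first exact: cvg_cst.
apply: cvgD; last exact: cvg_snd.
by apply: cvgMr_tmp; exact: cvg_fst.
Qed.

(** Each residual is at most c^(1/p) in absolute value, so the values of the line
    at x_j and x_k are bounded; their difference quotient bounds the slope, and
    then the value at x_j bounds the intercept. *)
Lemma Lp_objective_sublevel_bounded (j k : 'I_m) (c : R) :
    (pt j).1 != (pt k).1 ->
  exists M, forall ab, Lp_objective p pt ab <= c ->
    `|ab.1| <= M /\ `|ab.2| <= M.
Proof.
move=> xjk; pose K := c `^ p^-1.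
have p0 : 0 < p by exact: lt_trans p_gt1.
have le_residual ab i : Lp_objective p pt ab <= c -> `|residual ab i| <= K.
  move=> le_c; have le_i : `|residual ab i| `^ p <= c.
    apply: le_trans le_c; rewrite /Lp_objective (bigD1 i)//= lerDl.
    by apply: sumr_ge0 => l _; exact: powR_ge0.
  rewrite -[leLHS]powRr1// -(divff (lt0r_neq0 p0)) powRrM.
  apply: ge0_ler_powR; rewrite ?nnegrE ?invr_ge0 ?(ltW p0)// ?powR_ge0//.
  exact: le_trans (powR_ge0 _ _) le_i.
pose L := `|(pt j).2| + `|(pt k).2| + K.
have le_lin ab i : i \in [:: j; k] -> Lp_objective p pt ab <= c ->
    `|lin ab (pt i).1| <= L.
  move=> ijk /(le_residual _ i) leK.
  have -> : lin ab (pt i).1 = (pt i).2 - residual ab i.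
    by rewrite opprB addrC subrK.
  apply: le_trans (ler_normB _ _) _; apply: lerD => //.
  by move: ijk; rewrite !inE => /orP[]/eqP->; rewrite ?lerDl ?lerDr.
pose A := (L + L) / `|(pt j).1 - (pt k).1|; exists (A + (L + A * `|(pt j).1|)).
move=> ab le_c.
have lin_j := le_lin ab j (mem_head _ _) le_c.
have lin_k : `|lin ab (pt k).1| <= L by apply: le_lin; rewrite ?inE ?eqxx ?orbT.
have L0 : 0 <= L by exact: le_trans lin_j.
have leA : `|ab.1| <= A.
  rewrite ler_pdivlMr ?normr_gt0 ?subr_eq0// -normrM.
  have -> : ab.1 * ((pt j).1 - (pt k).1) = lin ab (pt j).1 - lin ab (pt k).1.
    by rewrite /lin; lra.
  by apply: le_trans (ler_normB _ _) _; exact: lerD.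
have A0 : 0 <= A by exact: le_trans leA.
have AM : 0 <= A * `|(pt j).1| by exact: mulr_ge0.
split; first by lra.
have -> : ab.2 = lin ab (pt j).1 - ab.1 * (pt j).1 by rewrite /lin; lra.
apply: le_trans (ler_normB _ _) _; rewrite normrM.
have : `|ab.1| * `|(pt j).1| <= A * `|(pt j).1| by exact: ler_wpM2r.
lra.
Qed.

(** The minimum over a compact box containing the sublevel set of the value at
    (0, 0) is global: outside the box the objective exceeds that value, and
    (0, 0) itself lies in the box. *)
Lemma minimal_Lp_distance_exists (j k : 'I_m) :
  (pt j).1 != (pt k).1 -> exists ab, minimal_Lp_distance p pt ab.
Proof.
move=> /(Lp_objective_sublevel_bounded (Lp_objective p pt (0, 0)))[M bounded].
pose box := [set` `[- M, M]] `*` [set` `[- M, M]].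
have boxE ab : box ab <-> `|ab.1| <= M /\ `|ab.2| <= M.
  by rewrite /box /= !in_itv /= -!ler_norml.
have box0 : box (0, 0) by apply/boxE/bounded.
have [||ab _ min_ab] := @compact_EVT_min _ _ (Lp_objective p pt) box _ _
    (continuous_subspaceT continuous_Lp_objective).
- by exists (0, 0).
- by apply: compact_setX; exact: segment_compact.
exists ab => ab'.
have [le0|/ltW gt0] :=
  leP (Lp_objective p pt ab') (Lp_objective p pt (0, 0)).
  by apply: min_ab; rewrite inE; exact/boxE/bounded.
by apply: le_trans gt0; apply: min_ab; rewrite inE.
Qed.

(** * The two balance equations *)

Lemma sum_signed_powR_residual (c : 'I_m -> R) ab :
  \sum_j c j * signed_powR (p - 1) (residual ab j) =
  \sum_(j in Jplus pt ab) c j * `|residual ab j| `^ (p - 1) -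
  \sum_(j in Jminus pt ab) c j * `|residual ab j| `^ (p - 1).
Proof.
have q0 : p - 1 != 0 by rewrite subr_eq0 gt_eqF.
rewrite [X in _ = X - _]big_mkcond [X in _ = _ - X]big_mkcond -sumrB.
apply: eq_bigr => j _; rewrite !inE -/(lin ab _) -subr_gt0 -[_ < lin _ _]subr_lt0 -/(residual ab j).
case: ltgtP => [r0|r0|<-]; last by rewrite signed_powR0 mulr0 subrr.
- by rewrite subr0 signed_powR_gt0E.
- rewrite sub0r -[residual ab j]opprK signed_powRN signed_powR_gt0E ?oppr_gt0//.
  by rewrite !normrN mulrN.
Qed.

End LpFit.

(** The directions (0, 1) and (1, 0) isolate the two equations from the
    vanishing of the slope; uniqueness is the strict tangent inequality at a
    minimizer, where the tangent plane is horizontal. *)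
Theorem theorem8 (R : realType) (m : nat) (hm : (2 <= m)%N)
    (pt : 'I_m -> R * R)
    (hx : forall j k : 'I_m, j != k -> (pt j).1 != (pt k).1)
    (p : R) (hp : 1 < p) :
  (exists! ab : R * R, minimal_Lp_distance p pt ab) /\
  (forall a b : R,
     minimal_Lp_distance p pt (a, b) <->
       \sum_(j in Jminus pt (a, b))
          `|(pt j).2 - a * (pt j).1 - b| `^ (p - 1) =
       \sum_(j in Jplus pt (a, b))
          `|(pt j).2 - a * (pt j).1 - b| `^ (p - 1)
       /\
       \sum_(j in Jminus pt (a, b))
          (pt j).1 * `|(pt j).2 - a * (pt j).1 - b| `^ (p - 1) =
       \sum_(j in Jplus pt (a, b))
          (pt j).1 * `|(pt j).2 - a * (pt j).1 - b| `^ (p - 1)).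
Proof.
pose j := Ordinal (ltnW hm); pose k := Ordinal hm.
have /hx xjk : j != k by [].
split.
  have [ab min_ab] := minimal_Lp_distance_exists hp xjk.
  exists ab; split=> // ab' min_ab'; apply/esym/eqP/negPn/negP => ne.
  have := Lp_objective_gt_tangent hp xjk ne.
  rewrite (minimal_iff_descent_rate0 _ hp _).1// mulr0 subr0.
  by rewrite ltNge min_ab'.
move=> a b; rewrite (minimal_iff_descent_rate0 _ hp).
have sumE (c : 'I_m -> R) (J : {set 'I_m}) :
    \sum_(i in J) c i * `|(pt i).2 - a * (pt i).1 - b| `^ (p - 1) =
    \sum_(i in J) c i * `|residual pt (a, b) i| `^ (p - 1).
  by apply: eq_bigr => i _; rewrite /residual /lin opprD addrA.
have sum1E (J : {set 'I_m}) :
    \sum_(i in J) `|(pt i).2 - a * (pt i).1 - b| `^ (p - 1) =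
    \sum_(i in J) 1 * `|residual pt (a, b) i| `^ (p - 1).
  by rewrite -sumE; apply: eq_bigr => i _; rewrite mul1r.
rewrite !sum1E !sumE.
have balance c := sum_signed_powR_residual pt hp c (a, b).
have := balance (fun=> 1); have := balance (fun i => (pt i).1) => /= Ex E1.
have {}E1 : \sum_i signed_powR (p - 1) (residual pt (a, b) i) = _ :=
  etrans (eq_bigr _ (fun i _ => esym (mul1r _))) E1.
split=> [stat|[e1 ex] d].
  have := stat (0, 1); have := stat (1, 0).
  by rewrite !descent_rateE /= Ex E1 => ? ?; split; lra.
by rewrite descent_rateE Ex E1 e1 ex !subrr !mulr0 addr0.
Qed.
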